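(* Let $R$ be a finite local commutative ring other than a field, with residue field $\mathbb F$, and let $K\le R^\times$ be strongly pure. Then $\mathcal C=\mathrm{Cyc}(K,R)$ is normal. Moreover, the natural mapping $\mathrm{Aut}_{\mathcal C}(R)\to\mathrm{Aut}_{\mathcal C}(\mathbb F)$ is a monomorphism.
   Context: All rings have an identity; $\mathrm{rad}(R)$ is the maximal ideal of the local ring $R$ and $\mathbb F=R/\mathrm{rad}(R)$, $\pi:R\to\mathbb F$ the natural epimorphism. $\mathrm{Cyc}(K,R)$ is the pair $(R,\mathrm{Rel}(K,R))$ with $\mathrm{Rel}(K,R)$ the relations $\{(x,y): y-x\in rK\}$, $r\in R$; $\mathrm{Aut}(\mathcal C)$ is the group of permutations of $R$ fixing each such relation. $\mathrm{A\Gamma L}_1(R)$ is the group of permutations $x\mapsto ax^\sigma+b$, $a\in R^\times$, $b\in R$, $\sigma\in\mathrm{Aut}(R)$; $\mathcal C$ is normal if $\mathrm{Aut}(\mathcal C)\le\mathrm{A\Gamma L}_1(R)$. $K$ is pure if the only ideal $I$ with $1+I\subseteq K$ is $\{0\}$. With $I_0=\{x\in\mathrm{rad}(R):x\,\mathrm{rad}(R)=\{0\}\}$ and $\pi_0:R\to R/I_0$, a group $K\le R^\times$ is strongly pure if it is pure and, unless $R$ is a field, $\pi_0(K)$ is a strongly pure subgroup of $(R/I_0)^\times$ (recursive definition). $\mathrm{Aut}_{\mathcal C}(R)=\mathrm{Aut}(\mathcal C)\cap\mathrm{Aut}(R)$, and $\mathrm{Aut}_{\mathcal C}(\mathbb F)=\mathrm{Aut}(\mathrm{Cyc}(\pi(K),\mathbb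 F))\cap\mathrm{Aut}(\mathbb F)$ (here $\mathrm{Cyc}(\pi(K),\mathbb F)$ is the quotient scheme of $\mathcal C$ modulo the equivalence with classes the cosets of $\mathrm{rad}(R)$). The natural mapping sends a ring automorphism of $R$ to the automorphism it induces on $\mathbb F$. *)

(* Defs.v *)
From HB Require Import structures.
From mathcomp Require Import all_boot all_order all_algebra all_fingroup.
Set Implicit Arguments. Unset Strict Implicit. Unset Printing Implicit Defensive.
Import GRing.Theory.
Local Open Scope ring_scope.

Section Defs.
Variable R : finComUnitRingType.

Definition is_ideal (I : {set R}) : Prop :=
  [/\ 0 \in I, (forall x y, x \in I -> y \in I -> x + y \in I),
      (forall x, x \in I -> - x \in I) &
      (forall r x, x \in I -> r * x \in I)].

Definition is_maximal_ideal (M : {set R}) : Prop :=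
  [/\ is_ideal M, 1 \notin M &
      forall I, is_ideal I -> M \subset I -> 1 \notin I -> I = M].

Definition local_with_rad (M : {set R}) : Prop :=
  is_maximal_ideal M /\ (forall N, is_maximal_ideal N -> N = M).

Definition Kset (K : {group {unit R}}) : {set R} := [set val u | u in K].

Definition scaleK (K : {group {unit R}}) (r : R) : {set R} :=
  [set r * k | k in Kset K].

(* Aut(Cyc(K,R)): permutations of R fixing each relation Rel_r = {(x,y) : y-x in rK}. *)
Definition in_AutC (K : {group {unit R}}) (f : R -> R) : Prop :=
  bijective f /\
  forall r x y, (f y - f x \in scaleK K r) = (y - x \in scaleK K r).

Definition is_ring_aut (s : R -> R) : Prop :=
  [/\ bijective s, (forall x y, s (x + y) = s x + s y),
      (forall x y, s (x * y) = s x * s y) & s 1 = 1].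

Definition in_AGammaL1 (f : R -> R) : Prop :=
  exists a b s, a \is a GRing.unit /\ is_ring_aut s /\ forall x, f x = a * s x + b.

Definition cyc_normal (K : {group {unit R}}) : Prop :=
  forall f : R -> R, in_AutC K f -> in_AGammaL1 f.

Definition in_AutC_ring (K : {group {unit R}}) (s : R -> R) : Prop :=
  is_ring_aut s /\ in_AutC K s.

(* The chain of ideals J_0 = 0, J_{k+1} = {x in M : x M \subseteq J_k}.
   R/J_{k+1} is (R/J_k)/I_0(R/J_k), where I_0 is the annihilator of rad in rad. *)
Fixpoint Jchain (M : {set R}) (k : nat) : {set R} :=
  match k with
  | 0 => [set 0]
  | k'.+1 => [set x in M | [forall y in M, x * y \in Jchain M k']]
  end.

(* pi(K) is pure in (R/J)^x : the only ideal Ibar of R/J (i.e. ideal I of R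
   containing J) with 1 + Ibar contained in pi(K) is the zero ideal (I = J). *)
Definition pure_mod (J : {set R}) (K : {group {unit R}}) : Prop :=
  forall I : {set R}, is_ideal I -> J \subset I ->
    (forall i, i \in I -> exists2 k, k \in Kset K & (1 + i) - k \in J) ->
    I = J.

Definition pure (K : {group {unit R}}) : Prop := pure_mod [set 0] K.

(* Strongly pure, with the recursion unfolded along the chain of quotients
   R = R/J_0 -> R/J_1 -> ...; the recursion continues at level k only while
   none of the previous quotients R/J_j (j < k) is a field, i.e. J_j <> M. *)
Definition strongly_pure (M : {set R}) (K : {group {unit R}}) : Prop :=
  forall k : nat, (forall j, (j < k)%N -> Jchain M j != M) -> pure_mod (Jchain M k) K.

End Defs.

(* Main.v *)
Require Import Defs.
From HB Require Import structures.
From mathcomp Require Import all_boot all_order all_algebra all_fingroup all_field.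
From mathcomp Require Import generic_quotient ring_quotient ring zify.
Set Implicit Arguments. Unset Strict Implicit. Unset Printing Implicit Defensive.
Import GRing.Theory.
Local Open Scope ring_scope.
Local Open Scope quotient_scope.

(* Let I0 be the annihilator of M in M and K0 the subgroup of I0 with
   K :&: (1 + I0) = 1 + K0; purity says that K0 contains no nonzero F-subspace
   of I0, so that an element of I0 vanishes as soon as all its multiples lie in
   K0. For f in Aut(C) and y - x a unit, f y - f x and y - x lie in the same
   K-orbit; moving y by v in I0 gives
     (f y - f x)^-1 (f (y + v) - f y) = (y - x)^-1 v  modulo K0,
   so that for each y the map 1 / (y - x) |-> 1 / (f y - f x) is additive
   modulo M, and by Hua's theorem f, once it fixes 0 and 1, is a field
   automorphism modulo M.

   If f is the identity modulo I0, then d x = f x - x is a function F -> I0 with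
   all difference quotients in K0. Such functions are affine: iterated
   differences reduce this to an additive d, and then l (d x / x) = 0 for every
   functional l killing K0; as a polynomial in x this has exponents p^i - p^j,
   which are pairwise distinct modulo #|F| - 1 for i <> j, so that d x = x (d 1).
   Hence f x = f 0 + x (1 + v). If f is a ring automorphism modulo I0 fixing 0 and 1,
   applying this to x |-> f (f^-1 x + a) - f a and x |-> f u^-1 f (u f^-1 x)
   shows that f is a ring automorphism. Strong purity makes the argument run
   along the quotients by I0, down to the ring in which I0 = M. *)

(** * Quotients by ideals and the residue field *)

Section IdealQuotient.
Variables (R : finComUnitRingType) (I : idealr R).
Local Notation Q := {ideal_quot I}.

HB.instance Definition _ : isCountable Q :=
  CanIsCountable (reprK : cancel repr \pi_Q).
HB.instance Definition _ : isFinite Q :=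
  CanIsFinite (reprK : cancel repr \pi_Q).
HB.instance Definition _ := FinRing.isNzRing.Build Q.

End IdealQuotient.

Lemma ideal_quotient (R : finComUnitRingType) (J : {set R}) :
    is_ideal J -> 1 \notin J ->
  exists (Q : finComUnitRingType) (pi : {rmorphism R -> Q}),
    (forall q, exists x, pi x = q) /\ (forall x, (pi x == 0) = (x \in J)).
Proof.
move=> [J0 JD JN JM] J1.
have clJ : idealr_closed (fun x => x \in J).
  by split=> // a u v uJ vJ; apply: JD (JM _ _ _) _.
pose I : idealr R := HB.pack (fun x => x \in J) (isIdealr.Build R _ clJ).
exists {ideal_quot I}, (\pi_({ideal_quot I})); split=> [q|x].
  by exists (repr q); exact: reprK.
rewrite -[x in RHS]subr0.
have := Quotient.idealrBE I x 0; rewrite [LHS]/= => ->.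
by rewrite [\pi_({ideal_quot I}) 0]rmorph0.
Qed.

Lemma residue_field (R : finComUnitRingType) (J : {set R}) :
    is_ideal J -> 1 \notin J -> (forall x, x \notin J -> x \is a GRing.unit) ->
  exists (F : finFieldType) (pi : {rmorphism R -> F}),
    (forall a, exists x, pi x = a) /\ (forall x, (pi x == 0) = (x \in J)).
Proof.
move=> idJ J1 unitJ.
have [Q [pi [piS piE]]] := ideal_quotient idJ J1.
have Qfield : GRing.field_axiom Q.
  move=> q; have [x <-] := piS q; rewrite piE => /unitJ Ux.
  exact: rmorph_unit.
pose F : finFieldType := HB.pack Q (GRing.ComUnitRing_isField.Build Q Qfield).
by exists F, pi.
Qed.

Lemma surjection_section (A : choiceType) (B : eqType) (f : A -> B) :
  (forall b, exists a, f a = b) -> exists s : B -> A, cancel s f.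
Proof.
move=> fS; have fS' b : exists a, f a == b by have [a /eqP] := fS b; exists a.
by exists (fun b => xchoose (fS' b)) => b; apply/eqP; exact: (xchooseP (fS' b)).
Qed.

Lemma pFrobenius_surj (F : finFieldType) p : p \in [pchar F] ->
  forall x : F, exists y, x = y ^+ p.
Proof.
move=> charFp x; have inj_f : injective (pFrobenius_aut charFp) by apply: fmorph_inj.
have [g _ gK] := injF_bij inj_f; exists (g x).
by rewrite -(pFrobenius_autE charFp) gK.
Qed.

(** * Additive polynomials over a finite field *)

Section AdditivePolynomials.
Variable F : finFieldType.
Local Notation q := #|F|%N.

Lemma poly_eq0_on_finField (P : {poly F}) :
  (size P <= q)%N -> (forall x, P.[x] = 0) -> P = 0.
Proof.
move=> szP P0; apply/eqP/negPn/negP => nzP.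
have := max_poly_roots nzP _ (enum_uniq F).
rewrite -cardE ltnNge szP; suff -> : all (root P) (enum F) by move/(_ isT).
by apply/allP => x _; rewrite rootE P0.
Qed.

Lemma finField_expf_pred (x : F) : x ^+ q.-1 = (x != 0)%:R.
Proof.
have q1 := finNzRing_gt1 F.
have [->|nzx] := eqVneq x 0; first by rewrite expr0n; case: q q1 => [|[]].
by apply: (mulfI nzx); rewrite -exprS (ltn_predK q1) expf_card mulr1.
Qed.

(** Lagrange interpolation: [1 - ('X - a%:P) ^+ q.-1] is 1 at [a] and 0 elsewhere. *)
Definition interpolation (f : F -> F) : {poly F} :=
  \sum_a f a *: (1 - ('X - a%:P) ^+ q.-1).

Lemma size_interpolation f : (size (interpolation f) <= q)%N.
Proof.
have q1 := finNzRing_gt1 F.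
apply: (leq_trans (size_sum _ _ _)); apply/bigmax_leqP => a _.
apply: (leq_trans (size_scale_leq _ _)).
apply: (leq_trans (size_polyD _ _)); rewrite size_poly1 size_polyN.
by rewrite size_exp_XsubC (ltn_predK q1) geq_max leqnn ltnW.
Qed.

Lemma horner_interpolation f x : (interpolation f).[x] = f x.
Proof.
rewrite horner_sum (bigD1 x) //= big1 => [|a neq_ax].
  by rewrite !hornerE finField_expf_pred subrr eqxx subr0 mulr1.
by rewrite !hornerE finField_expf_pred subr_eq0 eq_sym neq_ax subrr mulr0.
Qed.

Lemma interpolationD f g h : (forall x, h x = f x + g x) ->
  interpolation h = interpolation f + interpolation g.
Proof.
by move=> fg; rewrite -big_split; apply: eq_bigr => a _; rewrite fg scalerDl.
Qed.

Variables (p : nat) (charFp : p \in [pchar F]).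

Definition powp (m : nat) := exists i, m = (p ^ i)%N.

(** The derivative is constant, so apart from the linear term only exponents divisible by [p] occur.
    These terms form [r] evaluated at ['X^p]; as Frobenius is onto, [r] is again additive and
    induction on the size applies. *)
Lemma additive_poly_powp (P : {poly F}) m :
    (size P <= q)%N -> (forall x y, P.[x + y] = P.[x] + P.[y]) ->
  P`_m != 0 -> powp m.
Proof.
have p_pr := pcharf_prime charFp; have p_gt1 := prime_gt1 p_pr.
have [n] := ubnP (size P); elim: n P m => // n IHn P m; rewrite ltnS => szPn szPq addP.
have P0 : P`_0 = 0.
  by rewrite -horner_coef0; apply: (addIr P.[0]); rewrite -addP !add0r.
(* Comparing the linear terms in [h] of [P.[x + h] = P.[x] + P.[h]]. *)
have derP x : P^`().[x] = P`_1.
  pose T := \sum_(i < size P) P^`N(i).[x] *: 'X^i - (P + P.[x]%:P).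
  have szT : (size T <= q)%N.
    apply: leq_trans szPq; apply: (leq_trans (size_polyD _ _)).
    rewrite geq_max size_polyN; apply/andP; split.
      apply: (leq_trans (size_sum _ _ _)); apply/bigmax_leqP => i _.
      by apply: (leq_trans (size_scale_leq _ _)); rewrite size_polyXn.
    apply: (leq_trans (size_polyD _ _)); rewrite geq_max leqnn size_polyC.
    have [-> | nzP] := eqVneq P 0; first by rewrite horner0 eqxx.
    by rewrite (leq_trans (leq_b1 _)) // lt0n size_poly_eq0.
  have T0 h : T.[h] = 0.
    rewrite !hornerE horner_sum addrC [P.[h] + _]addrC -addP (nderiv_taylor _ (mulrC _ _)).
    apply/eqP; rewrite addrC subr_eq0; apply/eqP/eq_bigr => i _.
    by rewrite !hornerE.
  have /polyP/(_ 1%N) := poly_eq0_on_finField szT T0.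
  rewrite coef0 !coefB coef_sum coefD coefC addr0 => /eqP; rewrite subr_eq0.
  have [szP1 | szP1] := leqP (size P) 1.
    by rewrite (size1_polyC szP1) derivC horner0 coefC.
  rewrite (bigD1 (Ordinal szP1)) //= big1 => [|[i ltip] /= ne_i1].
    by rewrite coefZ coefXn eqxx mulr1 addr0 nderivn1 => /eqP.
  by rewrite coefZ coefXn eq_sym (negPf (ne_i1 : i != 1%N)) mulr0.
have coefP k : (1 < k)%N -> ~~ (p %| k)%N -> P`_k = 0.
  move=> k1 pk.
  have szD : (size (P^`() - (P`_1)%:P)%R <= q)%N.
    apply: leq_trans szPq; apply: (leq_trans (size_polyD _ _)).
    rewrite geq_max size_polyN; apply/andP; split.
      by rewrite (leq_trans (size_poly _ _)) ?leq_pred.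
    have [-> | nzP] := eqVneq P 0; first by rewrite coef0 size_polyC eqxx.
    rewrite size_polyC (leq_trans (leq_b1 _)) // lt0n size_poly_eq0 //.
  have /polyP/(_ k.-1) : P^`() - (P`_1)%:P = 0.
    by apply: poly_eq0_on_finField szD _ => x; rewrite !hornerE derP subrr.
  rewrite coefB coefC coef_deriv coef0 prednK ?(ltnW k1) //.
  have -> : (k.-1 == 0)%N = false by case: k k1 {pk} => [|[]].
  rewrite subr0 -mulr_natr => /eqP; rewrite mulf_eq0 => /orP[/eqP-> // |].
  by rewrite -(dvdn_pcharf charFp) (negPf pk).
move=> nzPm.
have m_gt0 : (0 < m)%N by case: m nzPm => //; rewrite P0 eqxx.
have [m_le1 | m_gt1] := leqP m 1.
  by exists 0%N; rewrite expn0; apply/eqP; rewrite eqn_leq m_le1.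
have /dvdnP[k def_m] : (p %| m)%N.
  by apply: contraNT nzPm => pm; rewrite coefP.
(* The truncation makes [r] shorter than [P] and loses nothing: if [i >= (size P).-1], then
   [p * i >= 2 * i >= size P]. *)
pose r := \poly_(i < (size P).-1) P`_(p * i).
have lt_mP : (m < size P)%N.
  by rewrite ltnNge; apply: contra nzPm => szm; rewrite nth_default.
have coef_r i : r`_i = P`_(p * i).
  rewrite coef_poly; case: ltnP => // le_i; rewrite nth_default //.
  have : (2 * i <= p * i)%N by rewrite leq_mul2r p_gt1 orbT.
  by move: (size P) (p * i)%N m_gt1 lt_mP le_i; lia.
have hr x : r.[x ^+ p] = P.[x] - P`_1 * x.
  have -> : P.[x] - P`_1 * x = (P - P`_1 *: 'X).[x] by rewrite !hornerE.
  rewrite -hornerXn -horner_comp; congr (_.[x]); apply/polyP => i.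
  rewrite coef_comp_poly_Xn ?prime_gt0 // coefB coefZ coefX coef_r.
  case: ifP => [pi | /negbT pi].
    rewrite mulnC divnK //.
    suff -> : (i == 1)%N = false by rewrite mulr0 subr0.
    by apply: contraTF pi => /eqP->; rewrite dvdn1 neq_ltn p_gt1 orbT.
  have [-> | ne_i1] := eqVneq i 1; first by rewrite mulr1 subrr.
  rewrite mulr0 subr0 coefP //; case: i pi ne_i1 => [|[]] //.
  by rewrite dvdn0.
have addr x y : r.[x + y] = r.[x] + r.[y].
  have [u ->] := pFrobenius_surj charFp x; have [v ->] := pFrobenius_surj charFp y.
  rewrite -!(pFrobenius_autE charFp) -rmorphD !(pFrobenius_autE charFp) !hr addP.
  by ring.
have [|||i def_k] := IHn r k _ _ addr.
- apply: leq_ltn_trans (size_poly _ _) _.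
  by rewrite prednK // (ltn_trans m_gt0 lt_mP).
- by apply: leq_trans (size_poly _ _) (leq_trans (leq_pred _) szPq).
- by rewrite coef_r mulnC -def_m.
by exists i.+1; rewrite def_m def_k expnSr.
Qed.

Lemma powp_double m l : powp m -> powp l -> (m < l)%N -> (2 * m <= l)%N.
Proof.
have p_gt1 := prime_gt1 (pcharf_prime charFp).
move=> [i ->] [j ->]; rewrite ltn_exp2l // => lt_ij.
by rewrite (leq_trans (leq_mul p_gt1 (leqnn _))) // -expnS leq_exp2l.
Qed.

Lemma powp_gt0 m : powp m -> (0 < m)%N.
Proof. by move=> [i ->]; rewrite expn_gt0 prime_gt0 ?(pcharf_prime charFp). Qed.

(** If the larger summands of the two sides differed, one would be at least twice the other, hence
    at least the whole opposite sum. *)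
Lemma powp_add_inj a b c d : powp a -> powp b -> powp c -> powp d ->
  (a + b = c + d)%N -> (a = c /\ b = d) \/ (a = d /\ b = c).
Proof.
move=> pa pb pc pd.
move: (powp_gt0 pa) (powp_gt0 pb) (powp_gt0 pc) (powp_gt0 pd).
move: (powp_double pa pc) (powp_double pa pd) (powp_double pb pc).
move: (powp_double pb pd) (powp_double pc pa) (powp_double pc pb).
move: (powp_double pd pa) (powp_double pd pb).
by clear; lia.
Qed.

(** The exponent of [x ^+ m / x ^+ l] for [x != 0], reduced by [x ^+ q.-1 = 1]; it is at most
    [q - 2] for [m] and [l] strictly between 0 and [q]. *)
Let expo m l := if (l <= m)%N then (m - l)%N else (m + q.-1 - l)%N.

(** The sums [m + l0] and [m0 + l] are equal or differ by [q.-1]. Powers below [q] are at most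
    [q / 2], so both sums lie between 2 and [q] and must be equal; [m0 != l0] excludes the crossed
    solution. *)
Lemma expo_inj m l m0 l0 : powp m -> powp l -> powp m0 -> powp l0 ->
    (m < q)%N -> (l < q)%N -> (m0 < q)%N -> (l0 < q)%N -> m0 != l0 ->
  expo m l = expo m0 l0 -> m = m0 /\ l = l0.
Proof.
move=> pm pl pm0 pl0 ltm ltl ltm0 ltl0 ne0.
have pq : powp q by exists (logn p q); apply: card_pprimeChar charFp.
move: (powp_double pm pq ltm) (powp_double pl pq ltl).
move: (powp_double pm0 pq ltm0) (powp_double pl0 pq ltl0).
move: (powp_gt0 pm) (powp_gt0 pl) (powp_gt0 pm0) (powp_gt0 pl0).
move: (powp_add_inj pm pl0 pm0 pl); rewrite /expo.
by case: (leqP l m); case: (leqP l0 m0); move: (q) ne0 ltm ltl ltm0 ltl0; clear; lia.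
Qed.

(* Both sides are polynomials in [x] and [y] whose exponents are powers of [p];
   on the hyperbola [xy = 1] the monomials off the diagonal stay independent,
   because the exponents [p^i - p^j] with [i <> j] are distinct mod [#|F| - 1]. *)
Lemma biadditive_factor_mul (beta : F -> F -> F) :
    (forall x y z, beta (x + y) z = beta x z + beta y z) ->
    (forall x y z, beta x (y + z) = beta x y + beta x z) ->
    (forall c, c != 0 -> beta c c^-1 = 0) ->
  forall x y, beta x y = beta 1 (x * y).
Proof.
move=> addl addr beta0.
have q1 := finNzRing_gt1 F.
pose b l x := (interpolation (beta x))`_l.
pose c m l := (interpolation (b l))`_m.
have bE l x : b l x = \sum_(m < q) c m l * x ^+ m.
  by rewrite -horner_coef_wide ?size_interpolation ?horner_interpolation.
have betaE x y : beta x y = \sum_(l < q) \sum_(m < q) c m l * (x ^+ m * y ^+ l).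
  rewrite -(horner_interpolation (beta x) y).
  rewrite (horner_coef_wide _ (size_interpolation _)); apply: eq_bigr => l _.
  by rewrite -/(b l x) bE mulr_suml; apply: eq_bigr => m _; rewrite mulrA.
have bD l x y : b l (x + y) = b l x + b l y.
  by rewrite /b (interpolationD (fun z => addl x y z)) coefD.
have c_powp m l : c m l != 0 -> powp m /\ powp l.
  move=> nzc; split.
    apply: additive_poly_powp nzc; first exact: size_interpolation.
    by move=> x y; rewrite !horner_interpolation bD.
  have [x nzb] : exists x, b l x != 0.
    apply/existsP; apply: contraNT nzc; rewrite negb_exists => /forallP b0.
    rewrite /c (_ : interpolation _ = 0) ?coef0 //.
    apply: poly_eq0_on_finField (size_interpolation _) _ => x.
    by rewrite horner_interpolation; apply/eqP/negPn.
  apply: additive_poly_powp nzb; first exact: size_interpolation.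
  by move=> y z; rewrite !horner_interpolation addr.
(* [Q] takes the value [beta x x^-1 = 0] at each [x != 0]. The factor ['X] below handles [x = 0],
   and the product still has size at most [q]. *)
pose Q := \sum_(l < q) \sum_(m < q) c m l *: 'X^(expo m l).
have szQ : (size ('X * Q)%R <= q)%N.
  rewrite mulrC; have [-> | nzQ] := eqVneq Q 0; first by rewrite mul0r size_poly0.
  rewrite size_mulX // -(ltn_predK q1) ltnS.
  apply: (leq_trans (size_sum _ _ _)); apply/bigmax_leqP => l _.
  apply: (leq_trans (size_sum _ _ _)); apply/bigmax_leqP => m _.
  have [-> | nzc] := eqVneq (c m l) 0; first by rewrite scale0r size_poly0.
  apply: (leq_trans (size_scale_leq _ _)); rewrite size_polyXn /expo.
  have [/powp_gt0 m_gt0 /powp_gt0 l_gt0] := c_powp _ _ nzc.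
  move: (ltn_ord m) (ltn_ord l) m_gt0 l_gt0.
  by case: (leqP l m); move: (q) q1 (m : nat) (l : nat); clear; lia.
have Q0 : Q = 0.
  suff /eqP : 'X * Q = 0 by rewrite mulf_eq0 polyX_eq0 => /eqP.
  apply: poly_eq0_on_finField szQ _ => x; rewrite hornerM hornerX.
  have [-> | nzx] := eqVneq x 0; first by rewrite mul0r.
  suff -> : Q.[x] = 0 by rewrite mulr0.
  rewrite -(beta0 _ nzx) betaE horner_sum; apply: eq_bigr => l _.
  rewrite horner_sum; apply: eq_bigr => m _; rewrite hornerZ hornerXn; congr (_ * _).
  have Ux : x \is a GRing.unit by rewrite unitfE.
  rewrite /expo exprVn; case: ifP => [le_lm | _]; first by rewrite exprB.
  rewrite exprB ?exprD ?finField_expf_pred ?nzx ?mulr1 //.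
  by apply: leq_trans (leq_addl _ _); rewrite -ltnS (ltn_predK q1).
(* By [expo_inj], no other nonzero term of [Q] has the exponent of an off-diagonal pair, so [c m l]
   is itself a coefficient of [Q]. *)
have c_diag (m l : 'I_q) : m != l -> c m l = 0.
  move=> ne_ml; apply/eqP/negPn/negP => nzc; have [pm pl] := c_powp _ _ nzc.
  case/negP: nzc; suff <- : Q`_(expo m l) = c m l by rewrite Q0 coef0.
  have expo_ne (m' l' : 'I_q) : (m' != m) || (l' != l) ->
      (c m' l' *: 'X^(expo m' l'))`_(expo m l) = 0.
    move=> ne; rewrite coefZ coefXn; case: eqP => [e_eq | _]; last by rewrite mulr0.
    apply/eqP; rewrite mulr1; apply: contraTT ne => nzc; have [pm' pl'] := c_powp _ _ nzc.
    have [] := expo_inj pm' pl' pm pl (ltn_ord m') (ltn_ord l') (ltn_ord m)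
      (ltn_ord l) ne_ml (esym e_eq).
    by move=> /val_inj-> /val_inj->; rewrite !eqxx.
  rewrite /Q coef_sum (bigD1 l) //= coef_sum (bigD1 m) //= coefZ coefXn eqxx mulr1.
  rewrite big1 ?addr0 => [|m' ne]; last by rewrite expo_ne // ne.
  rewrite big1 ?addr0 // => l' ne; rewrite coef_sum big1 // => m' _.
  by rewrite expo_ne // ne orbT.
move=> x y; rewrite !betaE; apply: eq_bigr => l _; apply: eq_bigr => m _.
have [-> | ne_ml] := eqVneq m l; last by rewrite c_diag // !mul0r.
by rewrite expr1n mul1r exprMn.
Qed.

End AdditivePolynomials.

(* The hypothesis says that [phi] is additive in every affine coordinate
   [1 / (y - x)] of the projective line that sends a point [y] to infinity;
   the conclusion is Hua's theorem. *)
Lemma Hua_multiplicative (F : finFieldType) (phi : F -> F) :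
    phi 0 = 0 -> phi 1 = 1 -> injective phi ->
    (forall y z z', (phi y - phi (y - (z + z')^-1))^-1 =
       (phi y - phi (y - z^-1))^-1 + (phi y - phi (y - z'^-1))^-1) ->
  (forall x y, phi (x + y) = phi x + phi y) /\
  (forall x y, phi (x * y) = phi x * phi y).
Proof.
move=> phi0 phi1 inj_phi; pose H y z := (phi y - phi (y - z^-1))^-1.
rewrite -/(forall y z z', H y (z + z') = H y z + H y z') => HD.
have H0 y : H y 0 = 0 by rewrite /H invr0 subr0 subrr invr0.
have HN y z : H y (- z) = - H y z.
  by apply/eqP; rewrite -subr_eq0 opprK -HD addNr H0.
pose h z := (phi z^-1)^-1.
have hE z : H 0 z = h z.
  by rewrite -[H 0 z]opprK -HN /H phi0 !sub0r invrN opprK invrN opprK.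
have hD z z' : h (z + z') = h z + h z' by rewrite -!hE HD.
have nz_phi x : x != 0 -> phi x != 0 by rewrite -{2}phi0 (inj_eq inj_phi).
have nz_h x : x != 0 -> h x != 0 by move=> nzx; rewrite invr_eq0 nz_phi ?invr_eq0.
have phiV x : phi x^-1 = (h x)^-1 by rewrite /h invrK.
have Hb b : H b^-1 b = h b by rewrite /H subrr phi0 subr0.
(* Additivity of [H b^-1] at [b + b ^+ 2 / c], whose inverse is [b^-1 - (b + c)^-1]. *)
have Hbc b c : b != 0 -> c != 0 -> H b^-1 (b ^+ 2 / c) = h b ^+ 2 / h c.
  move=> nzb nzc; have [def_c | ] := eqVneq (b + c) 0.
    have -> : c = - b by apply/eqP; rewrite -addr_eq0 addrC def_c.
    have -> : b ^+ 2 / - b = - b by field; rewrite ?oppr_eq0 nzb.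
    rewrite -(hE (- b)) !HN Hb hE; field.
    by rewrite ?oppr_eq0 nz_h.
  move=> nza; apply: (addrI (h b)); rewrite -{1}Hb -HD /H.
  have -> : b^-1 - (b + b ^+ 2 / c)^-1 = (b + c)^-1.
    field; rewrite nzc nzb nza /= ?andbT.
    by rewrite (_ : _ + _ = b * (b + c)) ?mulf_neq0 //; ring.
  rewrite !phiV hD.
  have nz_hbc : h b + h c != 0 by rewrite -hD nz_h.
  by field; rewrite !nz_h // nz_hbc.
have h1 : h 1 = 1 by rewrite /h invr1 phi1 invr1.
(* The case [b = 1] of [Hbc] identifies [phi] with the additive map [H 1]. Then every [H y] equals
   [h], and [Hbc] becomes [phi_sqr]. *)
have H1 t : H 1 t = phi t.
  have [-> | nzt] := eqVneq t 0; first by rewrite H0 phi0.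
  have := Hbc 1 t^-1 (oner_neq0 _).
  by rewrite invr_eq0 invr1 expr1n !mul1r invrK h1 expr1n mul1r /h invrK invrK; apply.
have phiD x y : phi (x + y) = phi x + phi y by rewrite -!H1 HD.
have phiN x : phi (- x) = - phi x by rewrite -!H1 HN.
have Hh y z : H y z = h z by rewrite /H phiD phiN opprD opprK addNKr.
have phih z : phi z = h z by rewrite -H1 Hh.
have phi_sqr b t : phi (b ^+ 2 * t) = phi b ^+ 2 * phi t.
  have [-> | nzb] := eqVneq b 0; first by rewrite phi0 !expr0n !mul0r.
  have [-> | nzt] := eqVneq t 0; first by rewrite mulr0 phi0 mulr0.
  have := Hbc b t^-1 nzb; rewrite invr_eq0 invrK => /(_ nzt).
  by rewrite Hh -!phih => ->; rewrite (phih t^-1) /h !invrK.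
split=> // x y.
have phi_sqr1 b : phi (b ^+ 2) = phi b ^+ 2.
  by rewrite -[b ^+ 2]mulr1 phi_sqr phi1 mulr1.
(* In characteristic 2 every [x] is a square; otherwise [phi_sqr] is polarised at [x + 1]. *)
have [char2 | nz2] := eqVneq (2%:R : F) 0.
  have /pFrobenius_surj/(_ x)[b ->] : 2 \in [pchar F] by rewrite inE /= char2 eqxx.
  by rewrite phi_sqr phi_sqr1.
apply: (mulfI nz2); have := phi_sqr (x + 1) y.
rewrite (_ : (x + 1) ^+ 2 * y = x ^+ 2 * y + (x * y + x * y) + y); last by ring.
rewrite !phiD phi_sqr phi1 => eq_xy; move: eq_xy.
rewrite (_ : (phi x + 1) ^+ 2 * phi y =
   phi x ^+ 2 * phi y + 2%:R * (phi x * phi y) + phi y); last by ring.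
by move/addIr/addrI <-; ring.
Qed.

(** * Local rings, the socle [I0] and the group [K0] *)

Section LocalRing.
Variables (R : finComUnitRingType) (M K : {set R}).

Definition unit_subgroup :=
  [/\ 1 \in K, {in K &, forall x y, x * y \in K}, {in K, forall x, x^-1 \in K}
    & {in K, forall x, x \is a GRing.unit}].

Definition local_ring :=
  is_ideal M /\ (forall x, (x \in M) = (x \isn't a GRing.unit)).

(** Membership in [Aut(C)] read at the relation with [r = y - x]. As [K] is a group of units, such
    maps are injective and closed under composition and inversion. *)
Definition respects_orbits (f : R -> R) :=
  forall x y, exists2 k, k \in K & f y - f x = (y - x) * k.

Local Notation I0 := (Jchain M 1).

(* [K0] is the additive subgroup of [I0] with [K :&: (1 + I0) = 1 + K0]; purity
   means that it contains no line of the [R/M]-vector space [I0]. *)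
Definition K0 : {set R} := [set v in I0 | 1 + v \in K].

Definition pure_socle := forall w, w \in I0 -> (forall x, x * w \in K0) -> w = 0.

Hypotheses (localM : local_ring) (grpK : unit_subgroup) (pureK : pure_socle).

Lemma localP x : (x \in M) = (x \isn't a GRing.unit). Proof. exact: localM.2. Qed.

Lemma M_D x y : x \in M -> y \in M -> x + y \in M.
Proof. by case: localM => -[_ MD _ _] _; apply: MD. Qed.

Lemma M_N x : x \in M -> - x \in M.
Proof. by case: localM => -[_ _ MN _] _; apply: MN. Qed.

Lemma M_B x y : x \in M -> y \in M -> x - y \in M.
Proof. by move=> Mx My; rewrite M_D ?M_N. Qed.

Lemma M_Ml r x : x \in M -> r * x \in M.
Proof. by case: localM => -[_ _ _ MM] _; apply: MM. Qed.

Lemma unit_addM u m : u \is a GRing.unit -> m \in M -> u + m \is a GRing.unit.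
Proof.
move=> Uu Mm; apply: contraT; rewrite -localP => Mum.
have : u \in M by rewrite -(addrK m u) M_B.
by rewrite localP Uu.
Qed.

Lemma I0P x : reflect (x \in M /\ forall m, m \in M -> m * x = 0) (x \in I0).
Proof.
apply: (iffP setIdP) => -[Mx x0]; split=> //.
  by move=> m Mm; move/forall_inP/(_ m Mm): x0; rewrite inE mulrC => /eqP.
by apply/forall_inP => m Mm; rewrite inE mulrC x0.
Qed.

Lemma I0_M x : x \in I0 -> x \in M. Proof. by case/I0P. Qed.

Lemma mulM_I0 m x : m \in M -> x \in I0 -> m * x = 0.
Proof. by move=> Mm /I0P[_]; apply. Qed.

Lemma I0_D x y : x \in I0 -> y \in I0 -> x + y \in I0.
Proof.
move=> /I0P[Mx x0] /I0P[My y0]; apply/I0P; split=> [|m Mm]; first exact: M_D.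
by rewrite mulrDr x0 ?y0 ?addr0.
Qed.

Lemma I0_Ml r x : x \in I0 -> r * x \in I0.
Proof.
move=> /I0P[Mx x0]; apply/I0P; split=> [|m Mm]; first exact: M_Ml.
by rewrite mulrCA x0 ?mulr0.
Qed.

Lemma I0_N x : x \in I0 -> - x \in I0.
Proof. by move=> I0x; rewrite -mulN1r I0_Ml. Qed.

Lemma I0_B x y : x \in I0 -> y \in I0 -> x - y \in I0.
Proof. by move=> Ix Iy; rewrite I0_D ?I0_N. Qed.

Lemma I0_0 : 0 \in I0.
Proof.
by apply/I0P; split=> [|m _]; [rewrite localP unitr0 | rewrite mulr0].
Qed.

Lemma congrM_I0 a b x : a - b \in M -> x \in I0 -> a * x = b * x.
Proof. by move=> Mab Ix; apply/eqP; rewrite -subr_eq0 -mulrBl mulM_I0. Qed.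

Lemma congrV_I0 a b x : a \is a GRing.unit -> b \is a GRing.unit -> a - b \in M ->
  x \in I0 -> a^-1 * x = b^-1 * x.
Proof.
move=> Ua Ub Mab Ix; apply: (mulrI Ua).
by rewrite mulVKr // (congrM_I0 Mab) ?mulVKr // I0_Ml.
Qed.

Lemma K0_I0 v : v \in K0 -> v \in I0. Proof. by case/setIdP. Qed.

Lemma K0_0 : 0 \in K0.
Proof. by case: grpK => K1 _ _ _; rewrite inE I0_0 addr0. Qed.

Lemma K0_D v w : v \in K0 -> w \in K0 -> v + w \in K0.
Proof.
case: grpK => _ KM _ _ /setIdP[Iv Kv] /setIdP[Iw Kw]; rewrite inE I0_D //=.
suff -> : 1 + (v + w) = (1 + v) * (1 + w) by rewrite KM.
by rewrite mulrDl mul1r mulrDr mulr1 (mulM_I0 (I0_M Iv) Iw) addr0 addrAC addrA.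
Qed.

Lemma K0_N v : v \in K0 -> - v \in K0.
Proof.
case: grpK => _ _ KV KU /setIdP[Iv Kv]; rewrite inE I0_N //=.
suff -> : 1 - v = (1 + v)^-1 by rewrite KV.
apply: (mulrI (KU _ Kv)); rewrite divrr ?KU //.
by rewrite mulrDl mul1r mulrBr mulr1 (mulM_I0 (I0_M Iv) Iv) subr0 subrK.
Qed.

Lemma K0_B v w : v \in K0 -> w \in K0 -> v - w \in K0.
Proof. by move=> Kv Kw; rewrite K0_D ?K0_N. Qed.

Lemma pure_socle_unit w : w \in I0 ->
  (forall u, u \is a GRing.unit -> u * w \in K0) -> w = 0.
Proof.
move=> Iw Kuw; apply: pureK => // x.
have [/Kuw // | ] := boolP (x \is a GRing.unit).
by rewrite -localP => Mx; rewrite mulM_I0 ?K0_0.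
Qed.

(** * Functions to [I0] with slopes in [K0] are affine *)

Definition slopes_in_K0 (d : {ffun R -> R}) :=
  (forall x, d x \in I0) /\
  (forall x y, y - x \is a GRing.unit -> (y - x)^-1 * (d y - d x) \in K0).

(** Seen from [x - u^-1], the points [x] and [x + m] have slopes with denominators congruent modulo
    [M]; subtracting gives [u * (d (x + m) - d x)] in [K0] for every unit [u]. *)
Lemma slopes_const_mod_M d x m : slopes_in_K0 d -> m \in M -> d (x + m) = d x.
Proof.
move=> [dI dK] Mm; apply/eqP; rewrite -subr_eq0; apply/eqP/pure_socle_unit.
  exact: I0_B.
move=> u Uu; have Uu' : u^-1 + m \is a GRing.unit by rewrite unit_addM ?unitrV.
have := K0_B (dK (x - u^-1) (x + m) _) (dK (x - u^-1) x _).
have -> : x + m - (x - u^-1) = u^-1 + m by ring.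
have -> : x - (x - u^-1) = u^-1 by ring.
rewrite (@congrV_I0 _ u^-1) ?unitrV ?I0_B //; last by rewrite addrAC subrr add0r.
by rewrite invrK -mulrBr opprB addrA subrK; apply.
Qed.

Definition Delta (a : R) (d : {ffun R -> R}) : {ffun R -> R} :=
  [ffun x => d (x + a) - d x].

Definition affine (d : {ffun R -> R}) :=
  [forall x, d x == d 0 + x * (d 1 - d 0)].

Lemma DeltaC a b d : Delta a (Delta b d) = Delta b (Delta a d).
Proof. by apply/ffunP => x; rewrite !ffunE (addrAC x b a); ring. Qed.

Lemma slopes_Delta a d : slopes_in_K0 d -> slopes_in_K0 (Delta a d).
Proof.
move=> [dI dK]; split=> [x|x y Uyx]; first by rewrite ffunE I0_B.
have := K0_B (dK (x + a) (y + a) _) (dK x y Uyx).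
have -> : y + a - (x + a) = y - x by ring.
rewrite -mulrBr !ffunE => /(_ Uyx).
by have -> : d (y + a) - d (x + a) - (d y - d x) =
  d (y + a) - d y - (d (x + a) - d x) by ring.
Qed.

Lemma affine_Delta a d : affine d -> affine (Delta a d).
Proof.
move/forallP => aff; apply/forallP => x; rewrite !ffunE; apply/eqP.
rewrite (eqP (aff (x + a))) (eqP (aff x)) (eqP (aff (0 + a))) (eqP (aff (1 + a))).
by ring.
Qed.

Lemma Newton_forward a (d : {ffun R -> R}) x n :
  d (x + a *+ n) = \sum_(i < n.+1) iter i (Delta a) d x *+ 'C(n, i).
Proof.
elim: n x => [|n IHn] x; first by rewrite mulr0n addr0 big_ord1 bin0 mulr1n.
have shift i : iter i (Delta a) d (x + a) = iter i (Delta a) d x + iter i.+1 (Delta a) d x.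
  by rewrite iterS [in RHS]ffunE addrCA subrr addr0.
rewrite mulrS addrA IHn.
under eq_bigr => i _ do rewrite shift mulrnDl.
rewrite big_split /= big_ord_recl [RHS]big_ord_recl !bin0 -addrA; congr (_ + _).
under [RHS]eq_bigr => i _ do rewrite binS mulrnDr.
rewrite big_split /=; congr (_ + _).
by rewrite big_ord_recr /= bin_small // mulr0n addr0.
Qed.

Lemma slopes_iter_Delta a d n : slopes_in_K0 d -> slopes_in_K0 (iter n (Delta a) d).
Proof. by move=> dS; elim: n => //= n; apply: slopes_Delta. Qed.

Lemma affine_iter_Delta a d n : affine d -> affine (iter n (Delta a) d).
Proof. by move=> aff; elim: n => //= n; apply: affine_Delta. Qed.

Lemma Delta_iter_Delta a b d n :
  Delta b (iter n (Delta a) d) = iter n (Delta a) (Delta b d).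
Proof. by elim: n => //= n IHn; rewrite DeltaC IHn. Qed.

(** In Newton's formula at [x + a *+ p] the left side is [d x], as [a *+ p] lies in [M]. The inner
    binomials are multiples of [p], which kills [I0], so only the [p]-th difference is left. *)
Lemma iter_Delta_char p a d : prime p -> p%:R \in M -> slopes_in_K0 d ->
  iter p (Delta a) d = 0.
Proof.
move=> p_pr Mp dS; apply/ffunP => x; rewrite ffunE.
have := Newton_forward a d x p.
have -> : a *+ p = a * p%:R by rewrite mulr_natr.
rewrite (slopes_const_mod_M _ dS (M_Ml _ Mp)) -(prednK (prime_gt0 p_pr)).
rewrite big_ord_recr big_ord_recl /= bin0 binn !mulr1n big1 => [|i _].
  by rewrite addr0 => /eqP; rewrite -subr_eq0 opprD addNKr oppr_eq0 => /eqP.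
rewrite prednK ?prime_gt0 // /bump /= add1n.
have /dvdnP[c ->] : (p %| 'C(p, i.+1))%N.
  by apply: prime_dvd_bin => //=; rewrite -[p in (_ < p)%N](prednK (prime_gt0 p_pr)) ltnS.
rewrite mulnC mulrnA -[_ *+ p]mulr_natl mulM_I0 ?mul0rn //.
by have [] := slopes_Delta a (slopes_iter_Delta a i dS).
Qed.

(* Since [Delta a] is nilpotent modulo [p], a non-affine function could be
   replaced by one all of whose differences are affine. *)
Lemma reduce_to_affine_Delta p d : prime p -> p%:R \in M ->
    slopes_in_K0 d -> ~~ affine d ->
  exists d', [/\ slopes_in_K0 d', ~~ affine d' & forall a, affine (Delta a d')].
Proof.
move=> p_pr Mp dS naff.
suff [d' [dS' naff' affD]] : exists d', [/\ slopes_in_K0 d', ~~ affine d'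
    & {in enum R, forall a, affine (Delta a d')}].
  by exists d'; split=> // a; rewrite affD ?mem_enum.
(* Shifts are treated one at a time: the last non-affine iterate under [Delta a] replaces [d']. As
   differences commute, those already affine stay so. *)
elim: (enum R) => [|a s [d' [dS' naff' affD]]]; first by exists d.
have ex_n : exists n, affine (iter n (Delta a) d').
  exists p; rewrite iter_Delta_char //; apply/forallP => x.
  by rewrite !ffunE subrr mulr0 addr0.
case: (ex_minnP ex_n) => -[|k] affk min_k; first by rewrite affk in naff'.
exists (iter k (Delta a) d'); split; first exact: slopes_iter_Delta.
  by apply/negP => /min_k; rewrite ltnn.
move=> b; rewrite inE => /predU1P[-> // | sb].
by rewrite Delta_iter_Delta affine_iter_Delta ?affD.
Qed.

(** The mixed second difference is [x * c a] and symmetric in [x] and [a], so [c a = a * c 1]. All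
    values of [c] lie in [K0], hence [c 1 = 0] by purity. *)
Lemma additive_of_affine_Delta d : slopes_in_K0 d ->
    (forall a, affine (Delta a d)) ->
  forall x y, d (x + y) + d 0 = d x + d y.
Proof.
move=> dS affD.
pose c a := d (1 + a) - d 1 - (d a - d 0).
have dE x a : d (x + a) - d x - d a + d 0 = x * c a.
  have /forallP/(_ x)/eqP := affD a; rewrite !ffunE add0r -/(c a) => eq_x.
  by rewrite eq_x; ring.
have cK a : c a \in K0.
  have [_ /(_ 0 1)] := slopes_Delta a dS.
  by rewrite subr0 unitr1 invr1 mul1r !ffunE add0r; apply.
have cE a : c a = a * c 1 by rewrite -dE /c (addrC a); ring.
have c1 : c 1 = 0.
  by apply: pureK => [|x]; [apply: K0_I0; apply: cK | rewrite -cE].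
move=> x y; have := dE x y; rewrite cE c1 !mulr0 => /eqP.
rewrite -addrA addr_eq0 opprD opprK => /eqP eq_d.
by apply: (addIr (- d x)); rewrite addrAC eq_d; ring.
Qed.

(** * Linearity over the residue field *)

Section ResidueField.
Variables (F : finFieldType) (pi : {rmorphism R -> F}).
Hypotheses (piS : forall a, exists x, pi x = a)
  (piE : forall x, (pi x == 0) = (x \in M)).
Variables (p : nat) (charFp : p \in [pchar F]).

Lemma char_in_M : p%:R \in M.
Proof. by rewrite -piE rmorph_nat pcharf0. Qed.

Definition subgroup (U : {set R}) :=
  (0 \in U) && [forall x in U, forall y in U, x - y \in U].

Lemma subgroupP (U : {set R}) : reflect
  (0 \in U /\ {in U &, forall x y, x - y \in U}) (subgroup U).
Proof.
apply: (iffP andP) => -[U0 UB]; split=> //.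
  by move=> x y Ux; move/forall_inP/(_ x Ux)/forall_inP: UB => /(_ y).
by apply/forall_inP => x Ux; apply/forall_inP => y; apply: UB.
Qed.

Lemma mulrn_char_I0 x n : x \in I0 -> x *+ n = x *+ (n %% p).
Proof.
move=> Ix; rewrite [in LHS](divn_eq n p) mulrnDr mulnC mulrnA.
by rewrite -[x *+ p]mulr_natl (mulM_I0 char_in_M Ix) mul0rn add0r.
Qed.

(* A subgroup maximal among those that avoid [w] has index [p] in [I0]. *)
Lemma separating_functional w : w \in I0 -> w \notin K0 ->
  exists l : R -> F,
    [/\ {in I0 &, forall x y, l (x + y) = l x + l y}, {in K0, forall v, l v = 0}
      & l w != 0].
Proof.
move=> Iw Kw; have p_pr := pcharf_prime charFp; have p_gt0 := prime_gt0 p_pr.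
pose P (U : {set R}) := [&& subgroup U, U \subset I0 & w \notin U].
have PK0 : P K0.
  rewrite /P Kw andbT; apply/andP; split.
    by apply/subgroupP; split; [apply: K0_0 | move=> x y; apply: K0_B].
  by apply/subsetP => v; apply: K0_I0.
have [U maxU sK0U] := maxset_exists PK0.
have /and3P[/subgroupP[U0 UB] /subsetP sUI nUw] := maxsetp maxU.
have UN x : x \in U -> - x \in U by move=> Ux; rewrite -sub0r UB.
have UD x y : x \in U -> y \in U -> x + y \in U.
  by move=> Ux Uy; rewrite -[y]opprK UB ?UN.
have UMn x n : x \in U -> x *+ n \in U.
  by move=> Ux; elim: n => [|n IHn]; rewrite ?mulr0n // mulrS UD.
have inv_mod n : (0 < n < p)%N -> exists m, forall x, x \in I0 -> x *+ n *+ m = x.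
  move=> /andP[n_gt0 ltnp]; case: (egcdnP p n_gt0) => m k eq_m _; exists m => x Ix.
  have /eqP gcd1 : coprime n p by rewrite coprime_sym prime_coprime // gtnNdvd.
  rewrite -mulrnA mulnC eq_m gcd1 mulrn_char_I0 // modnMDl.
  by rewrite modn_small ?prime_gt1 // mulr1n.
have wU z : z \in I0 -> exists n, z - w *+ n \in U.
  move=> Iz; have [Uz | nUz] := boolP (z \in U); first by exists 0; rewrite mulr0n subr0.
  (* [U'] is spanned by [U] and [z]. Maximality puts [w] into it, and inverting the coefficient of
     [z] modulo [p] expresses [z] by [w] modulo [U]. *)
  pose U' := [set x in I0 | [exists n : 'I_p, x - z *+ n \in U]].
  have memU' x n : x \in I0 -> x - z *+ n \in U -> x \in U'.
    move=> Ix Uxn; rewrite inE Ix; apply/existsP.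
    by exists (Ordinal (ltn_pmod n p_gt0)); rewrite /= -mulrn_char_I0.
  have sUU' : U \subset U'.
    by apply/subsetP => x Ux; rewrite (memU' x 0) ?sUI // mulr0n subr0.
  have U'z : z \in U' by rewrite (memU' z 1%N) // mulr1n subrr.
  have subU' : subgroup U'.
    apply/subgroupP; split=> [|x y]; first exact: (subsetP sUU').
    move=> /setIdP[Ix /existsP[n Un]] /setIdP[Iy /existsP[m Um]].
    apply: (memU' _ (n + (p - m))%N); first exact: I0_B.
    have -> : z *+ (n + (p - m)) = z *+ n - z *+ m.
      rewrite mulrnDr mulrnBr ?(ltnW (ltn_ord m)) // [z *+ p]mulrn_char_I0 // modnn.
      by rewrite mulr0n sub0r.
    rewrite opprD opprK addrACA UD //.
    by have := UN _ Um; rewrite opprB addrC.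
  have : w \in U'.
    apply: contraT => nU'w; case/maxsetP: maxU => _ /(_ U') maxU.
    case/negP: nUz; rewrite -maxU // /P subU' nU'w andbT.
    by apply/subsetP => x /setIdP[].
  case/setIdP=> _ /existsP[n Un].
  have n_gt0 : (0 < n)%N.
    by rewrite lt0n; apply: contraNneq nUw => n0; move: Un; rewrite n0 mulr0n subr0.
  have [|m nm] := inv_mod n; first by rewrite n_gt0 ltn_ord.
  exists m; rewrite -[z in z - _](nm z Iz) -mulrnBl -opprB mulNrn UN //.
  exact: UMn.
have uniq_n n m : w *+ n - w *+ m \in U -> (n%:R : F) = m%:R.
  wlog le_mn : n m / (m <= n)%N.
    case/orP: (leq_total m n) => ? wlg Unm; first exact: wlg.
    by apply/esym/wlg; rewrite // -opprB UN.
  rewrite -mulrnBr // => Unm; apply/eqP; rewrite -subr_eq0 -natrB //.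
  rewrite -(dvdn_pcharf charFp) /dvdn -leqn0 leqNgt; apply: contra nUw => lt0.
  have [|k kP] := inv_mod ((n - m) %% p)%N; first by rewrite lt0 ltn_mod.
  by rewrite -(kP w Iw) UMn // -mulrn_char_I0.
(* The coordinate of [z] along [w] modulo [U], well defined by [uniq_n]; by [wU] the default 0 does
   not occur on [I0]. *)
pose l z : F := if [pick n : 'I_p | z - w *+ n \in U] is Some n then n%:R else 0.
have lE z n : z \in I0 -> z - w *+ n \in U -> l z = n%:R.
  move=> Iz Un; rewrite /l; case: pickP => [m Um | /(_ (Ordinal (ltn_pmod n p_gt0)))].
    by apply: uniq_n; have := UB _ _ Un Um; rewrite opprB addrC addrA subrK.
  by rewrite /= -mulrn_char_I0 // Un.
exists l; split=> [x y Ix Iy | v Kv |].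
- have [n Un] := wU x Ix; have [m Um] := wU y Iy.
  rewrite (lE x n) // (lE y m) // (lE _ (n + m)%N) ?natrD ?I0_D //.
  by rewrite mulrnDr opprD addrACA UD.
- by rewrite (lE v 0) ?K0_I0 // mulr0n subr0 (subsetP sK0U).
by rewrite (lE w 1%N) ?mulr1n ?subrr // oner_neq0.
Qed.

(** Once [e] is additive, each functional [l] killing [K0] gives a biadditive map [l (b * e a)] on
    [F] that vanishes for [b = a^-1], hence depends on the product only. So no such [l] is nonzero
    on a multiple of [e x - x * e 1], and purity makes this element 0. *)
Lemma slopes_affine_over_residue_field d : slopes_in_K0 d -> affine d.
Proof.
move=> dS; apply: contraT => naff.
have [d' [dS' naff' affD]] :=
  reduce_to_affine_Delta (pcharf_prime charFp) char_in_M dS naff.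
case/negP: naff'.
have d'D := additive_of_affine_Delta dS' affD.
pose e x := d' x - d' 0; have [dI dK] := dS'.
have eD x y : e (x + y) = e x + e y.
  by apply: (addIr (d' 0 + d' 0)); rewrite /e [LHS]addrA subrK d'D; ring.
have eI x : e x \in I0 by rewrite I0_B.
have e_mod x y : x - y \in M -> e x = e y.
  by move=> Mxy; rewrite /e -(slopes_const_mod_M y dS' Mxy) [y + _]addrC subrK.
have eK x : x \is a GRing.unit -> x^-1 * e x \in K0.
  by move=> Ux; have := dK 0 x; rewrite subr0; apply.
apply/forallP => x; rewrite addrC -subr_eq -/(e x) -/(e 1).
rewrite -subr_eq0; apply/eqP/pureK => [|y]; first by rewrite I0_B ?I0_Ml.
apply: contraT => nKw.
have Iw : y * (e x - x * e 1) \in I0 by rewrite I0_Ml ?I0_B ?I0_Ml.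
have [l [lD lK nzl]] := separating_functional Iw nKw; case/negP: nzl.
have [s sK] := surjection_section piS.
have s_mod r a : pi r = a -> s a - r \in M.
  by move=> pir; rewrite -piE rmorphB sK pir subrr.
pose beta a b := l (s b * e (s a)).
have betaE r t : beta (pi r) (pi t) = l (t * e r).
  by rewrite /beta (e_mod _ r) ?s_mod // (@congrM_I0 _ t) ?s_mod.
have betaP : forall a b, beta a b = beta 1 (a * b).
  apply: (biadditive_factor_mul charFp) => [a b c | a b c | a nza].
  - rewrite /beta (e_mod _ (s a + s b)) ?s_mod ?rmorphD ?sK //.
    by rewrite eD mulrDr lD ?I0_Ml.
  - rewrite /beta (@congrM_I0 _ (s b + s c)) ?s_mod ?rmorphD ?sK //.
    by rewrite mulrDl lD ?I0_Ml.
  have Us : s a \is a GRing.unit by rewrite -[_ \is a _]negbK -localP -piE sK.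
  rewrite /beta (@congrM_I0 _ (s a)^-1) ?s_mod ?rmorphV ?sK //.
  by rewrite lK ?eK.
have := betaP (pi x) (pi y); rewrite -rmorphM -(rmorph1 pi) !betaE => l_eq.
apply/eqP; apply: (addIr (l (x * y * e 1))).
have /(lD _ _ Iw) <- : x * y * e 1 \in I0 by rewrite I0_Ml.
by rewrite add0r -[RHS]l_eq; congr l; ring.
Qed.

End ResidueField.

Lemma local_residue_field :
  exists (F : finFieldType) (pi : {rmorphism R -> F}),
    (forall a, exists x, pi x = a) /\ (forall x, (pi x == 0) = (x \in M)).
Proof.
apply: residue_field => [||x]; first by case: localM.
  by rewrite localP unitr1.
by rewrite localP negbK.
Qed.

Lemma slopes_affine d : slopes_in_K0 d -> affine d.
Proof.
move=> dS; have [F [pi [piS piE]]] := local_residue_field.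
by have [p _ charFp] := finPcharP F; apply: slopes_affine_over_residue_field charFp _ dS.
Qed.

(** * Maps that keep each difference in its [K]-orbit *)

Lemma respects_orbits_inj f : respects_orbits f -> injective f.
Proof.
case: grpK => _ _ _ KU fK x y eq_f; have [k /KU Uk] := fK x y.
by rewrite eq_f subrr -(mul0r k) => /(mulIr Uk)/eqP; rewrite eq_sym subr_eq0 => /eqP.
Qed.

Lemma respects_orbits_inv f g : cancel g f -> respects_orbits f -> respects_orbits g.
Proof.
case: grpK => _ _ KV KU gK fK x y; have [k Kk eq_k] := fK (g x) (g y).
by exists k^-1; rewrite ?KV // -[y in RHS]gK -[x in RHS]gK eq_k mulrK ?KU.
Qed.

Lemma respects_orbits_comp f g : respects_orbits f -> respects_orbits g ->
  respects_orbits (f \o g).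
Proof.
case: grpK => _ KM _ _ fK gK x y; have [k Kk eq_k] := gK x y.
by have [h Kh eq_h] := fK (g x) (g y); exists (k * h); rewrite ?KM //= eq_h eq_k mulrA.
Qed.

Lemma K_of_mod_I0 k : k \in K -> k - 1 \in I0 -> k - 1 \in K0.
Proof. by move=> Kk Ik; rewrite inE Ik addrC subrK. Qed.

(** The slope of [f x - x] over a unit difference is [k - 1] with [k] in [K], so [slopes_affine]
    applies; [v] is the slope from 0 to 1. *)
Lemma respects_orbits_near_id f : respects_orbits f -> f 0 = 0 ->
    (forall x, f x - x \in I0) ->
  exists2 v, v \in K0 & forall x, f x = x + x * v.
Proof.
move=> fK f0 fI; pose d := [ffun x => f x - x].
have dS : slopes_in_K0 d.
  split=> [x | x y Uyx]; first by rewrite ffunE.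
  have [k Kk eq_k] := fK x y.
  have eq_d : (y - x)^-1 * (d y - d x) = k - 1.
    apply: (mulrI Uyx); rewrite mulVKr // mulrBr -eq_k mulr1 !ffunE; ring.
  by rewrite eq_d K_of_mod_I0 // -eq_d I0_Ml // !ffunE I0_B.
have /forallP affd := slopes_affine dS; exists (d 1 - d 0).
  by have [_ /(_ 0 1)] := dS; rewrite subr0 unitr1 invr1 mul1r; apply.
move=> x; have /eqP := affd x; rewrite ![d 0]ffunE f0 subr0 add0r ffunE => <-.
by rewrite addrC subrK.
Qed.

(** * Ring homomorphisms modulo [I0] and modulo [M] *)

Definition ring_hom_mod (J : {set R}) (f : R -> R) :=
  (forall x y, f (x + y) - (f x + f y) \in J) /\
  (forall x y, f (x * y) - f x * f y \in J).

Lemma ring_hom_lift f : respects_orbits f -> f 0 = 0 -> f 1 = 1 ->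
    ring_hom_mod I0 f ->
  (forall x y, f (x + y) = f x + f y) /\ (forall x y, f (x * y) = f x * f y).
Proof.
move=> fK f0 f1 [fD fM]; have inj_f := respects_orbits_inj fK.
have [g fg gf] := injF_bij inj_f.
have gK := respects_orbits_inv gf fK.
have g0 : g 0 = 0 by rewrite -f0 fg.
have g1 : g 1 = 1 by rewrite -{1}f1 fg.
have addf x y : f (x + y) = f x + f y.
  have near a : exists2 v, v \in K0 & forall x, f (x + a) = f a + f x + f x * v.
    pose h x := f (g x + a) - f a.
    have [|||v Kv hE] := @respects_orbits_near_id h.
    - move=> u v; have [k Kk eq_k] := gK u v; have [l Kl eq_l] := fK (g u + a) (g v + a).
      exists (k * l); first by case: grpK => _ KM _ _; rewrite KM.
      transitivity (f (g v + a) - f (g u + a)); first by rewrite /h; ring.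
      by rewrite eq_l mulrA -eq_k; congr (_ * _); ring.
    - by rewrite /h g0 add0r subrr.
    - by move=> u; have := fD (g u) a; rewrite gf opprD addrA addrAC.
    by exists v => // z; have := hE (f z); rewrite /h fg -addrA => <-; rewrite addrC subrK.
  have [w Kw wE] := near 1.
  (* Computing [f (1 + a)] by [near a] and by [near 1] forces [v = f a * w]; as [f] is onto, all
     multiples of [w] lie in [K0]. *)
  have nearE a v : v \in K0 -> (forall x, f (x + a) = f a + f x + f x * v) -> v = f a * w.
    move=> Kv vE; have := vE 1; rewrite addrC wE f1 mul1r [1 + _]addrC.
    by move/addrI.
  have w0 : w = 0.
    apply: pureK => [|z]; first exact: K0_I0.
    by have [v Kv vE] := near (g z); rewrite -[z]gf -(nearE _ _ Kv vE).
  have [v Kv vE] := near y.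
  by rewrite vE (nearE _ _ Kv vE) w0 !mulr0 addr0 addrC.
have mulf u x : u \is a GRing.unit -> f (u * x) = f u * f x.
  move=> Uu; have [k Kk] := fK 0 u; rewrite f0 !subr0 => fu.
  have [_ KM KV KU] := grpK.
  have Ufu : f u \is a GRing.unit by rewrite fu unitrM Uu KU.
  pose h x := (f u)^-1 * f (u * g x).
  have [|||v Kv hE] := @respects_orbits_near_id h.
  - move=> y z; have [k1 Kk1 eq1] := gK y z; have [k2 Kk2 eq2] := fK (u * g y) (u * g z).
    exists (k1 * (k2 * k^-1)); first by rewrite !KM ?KV.
    rewrite /h -mulrBr eq2 -mulrBr eq1 fu invrM ?(KU k) // -[_ / u * _]mulrA.
    by rewrite -[u * _ * k2]mulrA mulKr // [LHS]mulrC -!mulrA.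
  - by rewrite /h g0 mulr0 f0 mulr0.
  - move=> y; have := I0_Ml (f u)^-1 (fM u (g y)).
    by rewrite gf mulrBr mulKr.
  have v0 : v = 0.
    by have := hE 1; rewrite /h g1 mulr1 mulVr // mul1r => /eqP; rewrite
      -subr_eq0 opprD addNKr oppr_eq0 => /eqP.
  have := hE (f x); rewrite v0 mulr0 addr0 /h fg => /(congr1 (fun z => f u * z)).
  by rewrite mulVKr.
split=> // x y; have [Ux | ] := boolP (x \is a GRing.unit); first exact: mulf.
rewrite -localP => Mx; have Ux : 1 + x \is a GRing.unit by rewrite unit_addM ?unitr1.
have := mulf _ y Ux; rewrite mulrDl mul1r !addf f1 mulrDl mul1r.
by move/addrI.
Qed.

(** Let [k] and [l] in [K] belong to the pairs [(x, y)] and [(x, y + v)]. Then [l / k - 1] lies in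
    [I0], so [l / k * v = v], and the expression reduces to [l / k - 1]. *)
Lemma respects_orbits_shift f x y v : respects_orbits f ->
    y - x \is a GRing.unit -> v \in I0 ->
  (f y - f x)^-1 * (f (y + v) - f y) - (y - x)^-1 * v \in K0.
Proof.
move=> fK Uyx Iv; have [_ KM KV KU] := grpK.
have [k Kk eq_k] := fK x y; have [l Kl eq_l] := fK x (y + v).
have [h Kh eq_h] := fK y (y + v).
have Uk := KU k Kk; set w := f (y + v) - f y in eq_h *.
have Iw : w \in I0 by rewrite eq_h addrAC subrr add0r mulrC I0_Ml.
have eq_w : (y - x) * (l - k) = w - l * v.
  have -> : w = (y + v - x) * l - (y - x) * k by rewrite -eq_l -eq_k /w; ring.
  by ring.
have Ilk : l / k - 1 \in I0.
  have -> : l / k - 1 = (k^-1 * (y - x)^-1) * (w - l * v).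
    by rewrite -eq_w -mulrA mulKr // mulrBr mulVr // mulrC.
  by apply/I0_Ml/I0_B/I0_Ml.
suff -> : (f y - f x)^-1 * w - (y - x)^-1 * v = l / k - 1.
  by rewrite K_of_mod_I0 ?KM ?KV.
have lkv : l / k * v = v by rewrite (congrM_I0 (I0_M Ilk) Iv) mul1r.
have -> : w = (y - x) * (l - k) + l * v by rewrite eq_w subrK.
rewrite eq_k invrM // mulrDr -[_ / (y - x) * (_ * _)]mulrA mulKr // mulrBr mulVr //.
rewrite [k^-1 * l]mulrC -[_ / (y - x) * (l * v)]mulrA mulrCA (mulrA k^-1) [k^-1 * l]mulrC.
by rewrite lkv addrK.
Qed.

(** For fixed [y], [h u * g v] and [u * v] agree modulo [K0], so the additivity defect [E] of [h]
    multiplies the image of [g], which is all of [I0], into [K0]. Were [E] a unit, [K0] would be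
    [I0], against purity at [w]. *)
Lemma ring_hom_mod_M f w : w \in I0 -> w != 0 ->
    respects_orbits f -> f 0 = 0 -> f 1 = 1 ->
  ring_hom_mod M f.
Proof.
move=> Iw nzw fK f0 f1; have [_ KM KV KU] := grpK.
have [F [pi [piS piE]]] := local_residue_field.
have piP x y : (pi x == pi y) = (x - y \in M) by rewrite -subr_eq0 -rmorphB piE.
have fM x y : (f x - f y \in M) = (x - y \in M).
  have [k /KU Uk ->] := fK y x; apply/idP/idP => [Mk | /(M_Ml k)]; last by rewrite mulrC.
  by rewrite -(mulrK Uk (x - y)) mulrC M_Ml.
have [s sK] := surjection_section piS.
pose phi a := pi (f (s a)).
have phiE x : phi (pi x) = pi (f x) by apply/eqP; rewrite piP fM -piP sK.
have [phiD phiM] : (forall x y, phi (x + y) = phi x + phi y) /\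
                   (forall x y, phi (x * y) = phi x * phi y).
  apply: Hua_multiplicative.
  - by rewrite -(rmorph0 pi) phiE f0.
  - by rewrite -(rmorph1 pi) phiE f1.
  - move=> a b; rewrite -(sK a) -(sK b) !phiE => /eqP.
    by rewrite piP fM -piP => /eqP.
  move=> a b c; have [y <-] := piS a; have [z <-] := piS b; have [t <-] := piS c.
  (* The value 0 at nonunits matches [0^-1 = 0] in [F], so that [hE] holds for all [u]. *)
  pose h u := if u \is a GRing.unit then (f y - f (y - u^-1))^-1 else 0.
  have Uh u : u \is a GRing.unit -> f y - f (y - u^-1) \is a GRing.unit.
    move=> Uu; have [k Kk ->] := fK (y - u^-1) y.
    by rewrite opprB addrC subrK unitrM unitrV Uu KU.
  have hE u : (phi (pi y) - phi (pi y - (pi u)^-1))^-1 = pi (h u).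
    rewrite /h; have [Uu | ] := boolP (u \is a GRing.unit).
      have -> : pi y - (pi u)^-1 = pi (y - u^-1) by rewrite rmorphB rmorphV.
      by rewrite !phiE [RHS]rmorphV ?Uh // rmorphB.
    by rewrite -localP -piE => /eqP->; rewrite invr0 subr0 subrr invr0 rmorph0.
  pose g v := f (y + v) - f y.
  have hg u v : v \in I0 -> h u * g v - u * v \in K0.
    move=> Iv; rewrite /h; have [Uu | ] := boolP (u \is a GRing.unit).
      have := @respects_orbits_shift f (y - u^-1) y v fK _ Iv.
      have -> : y - (y - u^-1) = u^-1 by ring.
      by rewrite unitrV invrK; apply.
    by rewrite -localP => Mu; rewrite mul0r mulM_I0 // subrr K0_0.
  have gI v : v \in I0 -> g v \in I0.
    move=> Iv; rewrite /g; have [k _ ->] := fK y (y + v).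
    by rewrite addrAC subrr add0r mulrC I0_Ml.
  have g_surj v : v \in I0 -> exists2 u, u \in I0 & v = g u.
    have inj_g : injective g.
      by move=> u1 u2 /addIr/(respects_orbits_inj fK)/addrI.
    suff eqI : I0 = g @: I0 by rewrite {1}eqI => /imsetP[u]; exists u.
    apply/esym/eqP; rewrite eqEcard card_imset // leqnn andbT.
    by apply/subsetP => _ /imsetP[u Iu ->]; apply: gI.
  have -> : pi z + pi t = pi (z + t) by rewrite rmorphD.
  rewrite !hE; pose E := h (z + t) - h z - h t.
  suff : pi E == 0 by rewrite /E !rmorphB -addrA -opprD subr_eq0 => /eqP.
  rewrite piE; apply: contraT; rewrite localP negbK => UE.
  case/eqP: nzw; apply: pureK => // x.
  have [u Iu eq_u] : exists2 u, u \in I0 & E^-1 * (x * w) = g u.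
    by apply: g_surj; rewrite !I0_Ml.
  have -> : x * w = E * g u by rewrite -eq_u mulVKr.
  have -> : E * g u = (h (z + t) * g u - (z + t) * u) -
      ((h z * g u - z * u) + (h t * g u - t * u)) by rewrite /E; ring.
  by apply: K0_B; [|apply: K0_D]; apply: hg.
by split=> x y; rewrite -piP -phiE ?rmorphD ?rmorphM ?phiD ?phiM !phiE.
Qed.

End LocalRing.

(** * Purity and the socle *)

Definition pure_mod_set (R : finComUnitRingType) (J K : {set R}) :=
  forall I : {set R}, is_ideal I -> J \subset I ->
    (forall i, i \in I -> exists2 k, k \in K & (1 + i) - k \in J) -> I = J.

(** [K] is a plain set, so that a quotient can use [pi @: K]. *)
Definition strongly_pure_set (R : finComUnitRingType) (M K : {set R}) :=
  forall k, (forall j, (j < k)%N -> Jchain M j != M) -> pure_mod_set (Jchain M k) K.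

Lemma pure_mod_socle (R : finComUnitRingType) (M K : {set R}) :
  pure_mod_set [set 0] K -> pure_socle M K.
Proof.
move=> pureK w Iw Kw; pose I := [set x * w | x : R].
have memI x : x * w \in I by apply/imsetP; exists x.
have eqI : I = [set 0].
  apply: pureK => [||_ /imsetP[x _ ->]].
  - split=> [|_ _ /imsetP[x _ ->] /imsetP[y _ ->]|_ /imsetP[x _ ->]|r _ /imsetP[x _ ->]].
    + by rewrite -(mul0r w).
    + by rewrite -mulrDl.
    + by rewrite -mulNr.
    + by rewrite mulrA.
  - by rewrite sub1set -(mul0r w).
  by exists (1 + x * w); [have /setIdP[] := Kw x | rewrite subrr inE].
by apply/set1P; rewrite -eqI -[w]mul1r.
Qed.

(* A nonzero element of [M] generating an ideal of minimal size is killed by [M]. *)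
Lemma socle_neq0 (R : finComUnitRingType) (M : {set R}) : local_ring M ->
  M != [set 0] -> exists2 w, w \in Jchain M 1 & w != 0.
Proof.
move=> localM nzM; have [[M0 _ _ MM] _] := localM.
have [w0 Mw0 nzw0] : exists2 w, w \in M & w != 0.
  have [w /andP[Mw nzw] | M_sub0] := pickP [pred w | (w \in M) && (w != 0)].
    by exists w.
  case/negP: nzM; rewrite eqEsubset sub1set M0 andbT; apply/subsetP => w Mw.
  by rewrite inE; apply: contraFT (M_sub0 w) => nzw; rewrite /= Mw.
pose I (w : R) := [set r * w | r : R].
have memI r w : r * w \in I w by apply/imsetP; exists r.
pose P w := (w \in M) && (w != 0).
have Pw0 : P w0 by rewrite /P Mw0.
case: (arg_minnP (fun w => #|I w|) Pw0) => w /andP[Mw nzw] min_w.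
exists w => //; apply/I0P; split=> // m Mm; apply/eqP.
apply: contraT => nzmw.
have := min_w (m * w); rewrite /P MM // nzmw => /(_ isT) le_size.
have : I (m * w) == I w.
  rewrite eqEcard le_size andbT; apply/subsetP => _ /imsetP[r _ ->].
  by rewrite mulrA.
move=> /eqP eqI; have := memI 1 w; rewrite -eqI mul1r => /imsetP[r _].
rewrite mulrA => /eqP; rewrite -[X in X == _]mul1r -subr_eq0 -mulrBl => /eqP eq0.
have Uu : 1 - r * m \is a GRing.unit.
  by rewrite (unit_addM localM) ?unitr1 // (M_N localM) // MM.
by case/eqP: nzw; apply: (mulrI Uu); rewrite eq0 mulr0.
Qed.

Lemma respects_orbits_near_id_eq (R : finComUnitRingType) (M K : {set R}) f :
    local_ring M -> unit_subgroup K -> pure_socle M K -> respects_orbits K f ->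
    f 0 = 0 -> f 1 = 1 -> (forall x, f x - x \in Jchain M 1) -> f =1 id.
Proof.
move=> localM grpK pureK fK f0 f1 fI x.
have [v _ vE] := respects_orbits_near_id localM grpK pureK fK f0 fI.
have := vE 1; rewrite f1 mul1r => /eqP; rewrite -subr_eq0 opprD addNKr oppr_eq0.
by move/eqP=> v0; rewrite vE v0 mulr0 addr0.
Qed.

(** * Passage to the quotient by the socle, and induction *)

Section QuotientBySocle.
Variables (R Q : finComUnitRingType) (pi : {rmorphism R -> Q}) (M K : {set R}).
Hypotheses (localM : local_ring M) (grpK : unit_subgroup K).
Hypotheses (piS : forall q, exists x, pi x = q)
  (piE : forall x, (pi x == 0) = (x \in Jchain M 1)).

Lemma mem_image_M x : (pi x \in pi @: M) = (x \in M).
Proof.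
apply/imsetP/idP => [[m Mm /eqP] | Mx]; last by exists x.
rewrite -subr_eq0 -rmorphB piE => /I0_M Mxm.
by rewrite -(subrK m x) (M_D localM).
Qed.

Lemma local_ring_quotient : local_ring (pi @: M).
Proof.
have [[M0 _ _ _] _] := localM; split.
  split=> [|_ _ /imsetP[x Mx ->] /imsetP[y My ->]|_ /imsetP[x Mx ->]|r _ /imsetP[x Mx ->]].
  - by rewrite -(rmorph0 pi) mem_image_M.
  - by rewrite -rmorphD mem_image_M (M_D localM).
  - by rewrite -rmorphN mem_image_M (M_N localM).
  by have [t <-] := piS r; rewrite -rmorphM mem_image_M (M_Ml localM).
move=> q; have [x <-] := piS q; rewrite mem_image_M (localP localM); congr (~~ _).
apply/idP/idP => [|Upi]; first exact: rmorph_unit.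
apply: contraT; rewrite -(localP localM) => Mx.
have [y piy] := piS (pi x)^-1.
have : pi (1 - y * x) == 0 by rewrite rmorphB rmorphM piy mulVr // rmorph1 subrr.
rewrite piE => /I0_M M1.
have : 1 \in M by rewrite -(subrK (y * x) 1) (M_D localM) ?(M_Ml localM).
by rewrite (localP localM) unitr1.
Qed.

Lemma unit_subgroup_image : unit_subgroup (pi @: K).
Proof.
have [K1 KM KV KU] := grpK.
split=> [|_ _ /imsetP[x Kx ->] /imsetP[y Ky ->]|_ /imsetP[x Kx ->]|_ /imsetP[x Kx ->]].
- by rewrite -(rmorph1 pi) imset_f.
- by rewrite -rmorphM imset_f ?KM.
- by rewrite -rmorphV ?KU // imset_f ?KV.
by rewrite rmorph_unit ?KU.
Qed.

(** The shift of index turns the unfolded form of strong purity back into the recursive one. *)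
Lemma mem_Jchain_quotient k x : (pi x \in Jchain (pi @: M) k) = (x \in Jchain M k.+1).
Proof.
elim: k x => [|k IHk] x; first by rewrite -piE inE.
rewrite !inE mem_image_M -/(Jchain M 1); congr (_ && _).
apply/forall_inP/forall_inP => [Jx y My | Jx _ /imsetP[y My ->]].
  by have := Jx _ (imset_f pi My); rewrite -rmorphM IHk.
by rewrite -rmorphM IHk Jx.
Qed.

Lemma strongly_pure_quotient : M != [set 0] -> strongly_pure_set M K ->
  strongly_pure_set (pi @: M) (pi @: K).
Proof.
move=> nzM spK k neqJ I [I0 ID IN IM] /subsetP sJI IK.
have memI x : (x \in [set x | pi x \in I]) = (pi x \in I) by rewrite inE.
suff eqI : [set x | pi x \in I] = Jchain M k.+1.
  apply/setP => q; have [x <-] := piS q.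
  by rewrite mem_Jchain_quotient -eqI memI.
(* The shifted condition has one new case, [j = 0], which is [M != [set 0]]. *)
apply: spK => [[|j] | | | i].
- by rewrite eq_sym.
- rewrite ltnS => /neqJ; apply: contraNneq => eqM; apply/eqP/setP => q.
  by have [x <-] := piS q; rewrite mem_Jchain_quotient eqM mem_image_M.
- split=> [|x y|x|r x]; rewrite !memI ?rmorph0 ?rmorphD ?rmorphN ?rmorphM //.
  + exact: ID.
  + exact: IN.
  exact: IM.
- by apply/subsetP => x; rewrite memI -mem_Jchain_quotient => /sJI.
rewrite memI => /IK[_ /imsetP[h Kh ->]].
by rewrite -(rmorph1 pi) -rmorphD -rmorphB mem_Jchain_quotient; exists h.
Qed.

Lemma respects_orbits_quotient f : respects_orbits K f ->
  exists2 fQ : Q -> Q, respects_orbits (pi @: K) fQ & forall x, fQ (pi x) = pi (f x).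
Proof.
move=> fK; have [s sK] := surjection_section piS.
exists (fun q => pi (f (s q))) => [a b | x].
  have [k Kk eq_k] := fK (s a) (s b); exists (pi k); first exact: imset_f.
  by rewrite -rmorphB eq_k rmorphM rmorphB !sK.
apply/eqP; rewrite -subr_eq0 -rmorphB piE.
have [k _ ->] := fK x (s (pi x)).
by rewrite mulrC (I0_Ml localM) // -piE rmorphB sK subrr.
Qed.

End QuotientBySocle.

(** Induction on the size of [R], passing to the quotient by [I0] unless [I0 = M]. The last clause,
    which gives injectivity of the natural mapping, follows along: [f] trivial modulo [M] is trivial
    on the quotient, so modulo [I0], hence everywhere. *)
Lemma respects_orbits_ring_aut n (R : finComUnitRingType) (M K : {set R}) :
    (#|R| < n)%N -> local_ring M -> M != [set 0] -> unit_subgroup K ->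
    strongly_pure_set M K ->
  forall f, respects_orbits K f -> f 0 = 0 -> f 1 = 1 ->
    [/\ forall x y, f (x + y) = f x + f y, forall x y, f (x * y) = f x * f y
      & (forall x, f x - x \in M) -> f =1 id].
Proof.
elim: n R M K => // n IHn R M K ltRn localM nzM grpK spK f fK f0 f1.
have pureK : pure_socle M K by apply/pure_mod_socle/(spK 0).
have near_id := respects_orbits_near_id_eq localM grpK pureK fK f0 f1.
have [w Iw nzw] := socle_neq0 localM nzM.
have lift := ring_hom_lift localM grpK pureK fK f0 f1.
have [eqIM | neqIM] := eqVneq (Jchain M 1) M.
  have [|fD fM] := lift.
    by rewrite eqIM; apply: ring_hom_mod_M Iw nzw fK f0 f1.
  by split=> // fM_id; apply: near_id => x; rewrite eqIM.
have idI : is_ideal (Jchain M 1).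
  split; [exact: I0_0 localM | exact: I0_D localM | exact: I0_N localM | exact: I0_Ml localM].
have I1 : 1 \notin Jchain M 1.
  by apply/negP => /I0_M; rewrite (localP localM) unitr1.
have [Q [pi [piS piE]]] := ideal_quotient idI I1.
(* The quotient is smaller because [w] and 0 have the same image. *)
have ltQn : (#|Q| < n)%N.
  apply: leq_trans (_ : #|R| <= n)%N; last by rewrite -ltnS.
  have imw : pi @: [set~ w] = [set: Q].
    apply/setP => q; rewrite inE; have [x <-] := piS q.
    have [-> | nxw] := eqVneq x w; last by rewrite imset_f // !inE.
    have /eqP -> : pi w == 0 by rewrite piE.
    by rewrite -(rmorph0 pi) imset_f // !inE eq_sym.
  apply: leq_ltn_trans (_ : #|[set~ w]| < _)%N.
    by rewrite -cardsT -imw leq_imset_card.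
  by rewrite cardsC1 ltn_predL (cardD1 w).
have nzMQ : pi @: M != [set 0].
  apply: contraNneq neqIM => eqMQ; rewrite eqEsubset; apply/andP; split.
    by apply/subsetP => x /I0_M.
  by apply/subsetP => x Mx; rewrite -piE -in_set1 -eqMQ imset_f.
have [fQ fQK fQE] := respects_orbits_quotient localM piS piE fK.
have fQ0 : fQ 0 = 0 by rewrite -(rmorph0 pi) fQE f0.
have fQ1 : fQ 1 = 1 by rewrite -(rmorph1 pi) fQE f1.
have [fQD fQM fQid] := IHn Q _ _ ltQn (local_ring_quotient localM piS piE) nzMQ
  (unit_subgroup_image pi grpK) (strongly_pure_quotient localM piS piE nzM spK)
  fQ fQK fQ0 fQ1.
have [|fD fM] := lift.
  split=> x y; rewrite -piE rmorphB ?rmorphD ?rmorphM -!fQE ?rmorphD ?rmorphM.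
    by rewrite fQD subrr.
  by rewrite fQM subrr.
split=> // f_id; apply: near_id => x; rewrite -piE rmorphB -fQE fQid ?subrr // => q.
by have [y <-] := piS q; rewrite fQE -rmorphB (mem_image_M localM piE).
Qed.

(** * Back to the definitions of the statement *)

Lemma local_with_rad_local_ring (R : finComUnitRingType) (M : {set R}) :
  local_with_rad M -> local_ring M.
Proof.
move=> [[idM M1 _] uniqM]; split=> // x; have [_ _ _ MM] := idM.
have [Ux | nUx] := boolP (x \is a GRing.unit).
  by apply: contraNF M1 => Mx; rewrite -(mulVr Ux) MM.
(* A boolean form of [is_ideal], for [maxset]: a nonunit [x] lies in some maximal ideal, which is
   [M] by uniqueness. *)
pose idealb (I : {set R}) := [&& 0 \in I, [forall a in I, forall b in I, a + b \in I],
  [forall a in I, - a \in I] & [forall r, forall a in I, r * a \in I]].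
have idealP I : reflect (is_ideal I) (idealb I).
  apply: (iffP and4P) => -[I0 ID IN IM]; split=> //.
  - by move=> a b Ia; move/forall_inP/(_ a Ia)/forall_inP: ID; apply.
  - by move=> a; move/forall_inP: IN; apply.
  - by move=> r a; move/forallP/(_ r)/forall_inP: IM; apply.
  - by apply/forall_inP => a Ia; apply/forall_inP => b; apply: ID.
  - exact/forall_inP.
  by apply/forallP => r; apply/forall_inP => a; apply: IM.
pose P I := idealb I && (1 \notin I).
pose xR := [set r * x | r : R].
have memxR r : r * x \in xR by apply/imsetP; exists r.
have PxR : P xR.
  apply/andP; split.
    apply/idealP; split=> [|_ _ /imsetP[a _ ->] /imsetP[b _ ->]|_ /imsetP[a _ ->]|
        r _ /imsetP[a _ ->]].
    - by rewrite -(mul0r x).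
    - by rewrite -mulrDl.
    - by rewrite -mulNr.
    by rewrite mulrA.
  apply/negP => /imsetP[r _ r1]; case/negP: nUx.
  by apply/unitrPr; exists r; rewrite mulrC.
have [N maxN sxN] := maxset_exists PxR.
have /andP[/idealP idN N1] := maxsetp maxN.
rewrite -(uniqM N); first by apply: (subsetP sxN); rewrite -[x]mul1r.
split=> // I idI sNI I1; have [_] := maxsetP maxN; apply=> //.
by apply/andP; split=> //; apply/idealP.
Qed.

Lemma Kset_unit_subgroup (R : finComUnitRingType) (K : {group {unit R}}) :
  unit_subgroup (Kset K).
Proof.
split=> [|_ _ /imsetP[u Ku ->] /imsetP[v Kv ->]|_ /imsetP[u Ku ->]|_ /imsetP[u Ku ->]].
- by apply/imsetP; exists 1%g; rewrite ?group1.
- by apply/imsetP; exists (u * v)%g; rewrite ?groupM.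
- by apply/imsetP; exists u^-1%g; rewrite ?groupV.
exact: (valP u).
Qed.

Lemma in_AutC_respects (R : finComUnitRingType) (K : {group {unit R}}) f :
  in_AutC K f -> respects_orbits (Kset K) f.
Proof.
move=> [_ fK] x y; have : f y - f x \in scaleK K (y - x).
  have [K1 _ _ _] := Kset_unit_subgroup K.
  by rewrite fK; apply/imsetP; exists 1; rewrite ?mulr1.
by case/imsetP=> k Kk eq_k; exists k.
Qed.

Theorem theorem6p2 (R : finComUnitRingType) (M : {set R})
  (K : {group {unit R}}) :
  local_with_rad M ->
  ~ (forall x : R, x != 0 -> x \is a GRing.unit) ->
  strongly_pure M K ->
  cyc_normal K /\
  (forall s t : R -> R, in_AutC_ring K s -> in_AutC_ring K t ->
     (forall x, s x - t x \in M) -> s =1 t).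
Proof.
move=> /local_with_rad_local_ring localM not_field spK.
have grpK := Kset_unit_subgroup K; have [K1 KM KV KU] := grpK.
have nzM : M != [set 0].
  apply/eqP => M0; apply: not_field => x nzx.
  by rewrite -[_ \is a _]negbK -(localP localM) M0 inE.
have ring_aut := respects_orbits_ring_aut (ltnSn #|R|) localM nzM grpK spK.
split=> [f /in_AutC_respects fK | s t [[_ sD _ s1] /in_AutC_respects sK]
    [[bij_t tD _ t1] /in_AutC_respects tK] st_M].
  have [a Ka] := fK 0 1; rewrite subr0 mul1r => fa.
  have Ua : a \is a GRing.unit by apply: KU.
  (* [f] normalised to fix 0 and 1; as [a = f 1 - f 0] is in [K], orbits are still respected. *)
  pose s x := a^-1 * (f x - f 0).
  have sK : respects_orbits (Kset K) s.
    move=> x y; have [k Kk eq_k] := fK x y.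
    exists (k * a^-1); first by rewrite KM ?KV.
    by rewrite /s -mulrBr opprB addrA subrK eq_k mulrC mulrA.
  have s0 : s 0 = 0 by rewrite /s subrr mulr0.
  have s1 : s 1 = 1 by rewrite /s fa mulVr.
  have [sD sM _] := ring_aut s sK s0 s1.
  exists a, (f 0), s; split=> //; split=> [|x].
    by split=> //; apply/injF_bij/(respects_orbits_inj grpK sK).
  by rewrite /s mulVKr // subrK.
have additive0 (r : R -> R) : (forall x y, r (x + y) = r x + r y) -> r 0 = 0.
  by move=> rD; apply: (addIr (r 0)); rewrite -rD !add0r.
(* [g \o s] is the quotient of [s] by [t]; it is trivial modulo [M], so the last clause of
   [ring_aut] makes it the identity. *)
have [g tg gt] := bij_t.
have hK := respects_orbits_comp grpK (respects_orbits_inv grpK gt tK) sK.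
have h0 : (g \o s) 0 = 0 by rewrite /= (additive0 s sD) -[in LHS](additive0 t tD) tg.
have h1 : (g \o s) 1 = 1 by rewrite /= s1 -[in LHS]t1 tg.
have [_ _ h_id] := ring_aut _ hK h0 h1.
move=> x; rewrite -[s x]gt -/((g \o s) x) h_id // => y.
have [k Kk] := tK y (g (s y)); rewrite gt => eq_k.
rewrite -[_ - y](mulrK (KU k Kk)) -eq_k mulrC (M_Ml localM) //.
Qed.
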